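(* Let $R(z):=-z-2\log(1-z)$ for $z\in\mathbb{D}=\{z\in\mathbb{C}:|z|<1\}$ (with the branch of $\log$ satisfying $\log 1=0$), and for $t\in[0,2\pi)$ let $R_t(z):=e^{it}R(e^{-it}z)$. For every real $s$ with $0<s<\dfrac{\log 2}{\pi+\log 2}$, the function $$F_s(z):=sR(z)+(1-s)R_{\pi/2}(z)$$ belongs to $\mathcal{R}\setminus\mathcal{S}^{*}$.
   Context: $\mathcal{A}$ is the class of holomorphic functions $f$ on $\mathbb{D}$ with $f(0)=0$ and $f'(0)=1$. $\mathcal{R}:=\{f\in\mathcal{A}:\operatorname{Re} f'(z)>0\text{ for all }z\in\mathbb{D}\}$. $\mathcal{S}$ is the class of univalent (injective) functions in $\mathcal{A}$. $\mathcal{S}^{*}$ is the class of starlike functions in $\mathcal{S}$, where a holomorphic function $g$ on $\mathbb{D}$ with $g(0)=0$ is starlike if $\operatorname{Re}[zg'(z)/g(z)]>0$ for all $z\in\mathbb{D}$ (the quotient being understood at $z=0$ by its limit). *)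

(* Defs.v *)
From Stdlib Require Import Reals.
From Coquelicot Require Import Coquelicot.
Open Scope R_scope.

Definition in_disk (z : C) : Prop := Cmod z < 1.

(* Functions on the disk are represented by total functions [C -> C] of which
   only the values on the disk matter: the disk is open, so differentiability
   and [C_derive] at a point of it depend on nothing else.
   Pitfall: [C_derive f z] is the complex derivative only when [f] is
   complex-differentiable at [z]; in general it is computed from a limit along
   a real direction. All uses below are guarded by [holomorphic_on_disk]. *)
Definition holomorphic_on_disk (f : C -> C) : Prop :=
  forall z : C, in_disk z -> @ex_derive C_AbsRing C_NormedModule f z.

Definition class_A (f : C -> C) : Prop :=
  holomorphic_on_disk f /\ f 0%C = 0%C /\ C_derive f 0%C = 1%C.

Definition class_R (f : C -> C) : Prop :=
  class_A f /\ forall z : C, in_disk z -> 0 < Re (C_derive f z).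

Definition class_S (f : C -> C) : Prop :=
  class_A f /\
  forall z w : C, in_disk z -> in_disk w -> f z = f w -> z = w.

(* For z <> 0 the quotient must be defined, hence g z <> 0 (a zero of g other
   than the origin would be a pole of g'/g); at the origin its value is its
   limit there. *)
Definition starlike (g : C -> C) : Prop :=
  holomorphic_on_disk g /\ g 0%C = 0%C /\
  (forall z : C, in_disk z -> z <> 0%C ->
     g z <> 0%C /\ 0 < Re (z * C_derive g z / g z)%C) /\
  (exists l : C,
     filterlim (fun z : C => (z * C_derive g z / g z)%C)
       (locally' (0%C : C)) (locally l) /\
     0 < Re l).

Definition class_Sstar (f : C -> C) : Prop := class_S f /\ starlike f.

(* Principal argument, in ]-PI, PI], and principal logarithm, of a nonzero
   complex number. *)
Definition Carg (z : C) : R :=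
  if Rle_dec 0 (Im z) then acos (Re z / Cmod z) else - acos (Re z / Cmod z).

Definition Clog (z : C) : C := (ln (Cmod z), Carg z).

Definition cis (t : R) : C := (cos t, sin t).

Definition Rfun (z : C) : C := (- z - 2 * Clog (1 - z))%C.

Definition Rrot (t : R) (z : C) : C := (cis t * Rfun (cis (- t) * z))%C.

Definition Ffun (s : R) (z : C) : C :=
  (s * Rfun z + (1 - s) * Rrot (PI / 2) z)%C.

(* Main.v *)
(* Since [R'(z) = (1 + z) / (1 - z)] has positive real part on the disk, so has
   [F'], a convex combination of rotations of it. For the failure of
   starlikeness, let [z] tend to 1 tangentially to the unit circle from above:
   [z F'(z)] is then close to a large positive multiple of [i], while
   [Re F(z)] tends to infinity and
   [Im F(z)] tends to [s * PI - (1 - s) * ln 2], which is negative exactly when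
   [s < ln 2 / (PI + ln 2)]. On the curve [z = (1 - y^2, y)], [Re (z F'(z))]
   tends to [- s]; hence [Re (z F'(z) / F(z)) < 0] for small [y > 0]. *)

Require Import Defs.
From Stdlib Require Import Reals Lra.
From Coquelicot Require Import Coquelicot.
Open Scope R_scope.

(** * Complex derivatives from real partial derivatives *)

(** The Cauchy-Riemann form of the partials makes the real differential equal to multiplication by
    [a + i b]. Each component then has error at most [eps / 2] times the sup norm, and [Cmod] is at
    most [sqrt 2 <= 2] times the sup norm. *)
Lemma is_derive_Cauchy_Riemann (u v : R -> R -> R) (x y a b : R) :
  differentiable_pt_lim u x y a (- b) ->
  differentiable_pt_lim v x y b a ->
  @is_derive C_AbsRing C_NormedModule
    (fun z : C => (u (Re z) (Im z), v (Re z) (Im z))) (x, y) (a, b).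
Proof.
  intros Hu Hv. split.
  - apply (is_linear_scal_l (K := C_AbsRing) (V := C_NormedModule)).
  - intros z0 Hz0 eps.
    rewrite <- (is_filter_lim_locally_unique _ _ Hz0).
    destruct (Hu (pos_div_2 eps)) as [du Hdu].
    destruct (Hv (pos_div_2 eps)) as [dv Hdv].
    assert (Hd : 0 < Rmin du dv) by (apply Rmin_pos; apply cond_pos).
    exists (mkposreal _ Hd). intros [p q] Hz.
    change (Cmod ((p, q) - (x, y))%C < Rmin du dv) in Hz.
    change (Cmod (((u p q, v p q) - (u x y, v x y)) - ((p, q) - (x, y)) * (a, b))%C
      <= eps * Cmod ((p, q) - (x, y))%C).
    pose proof (Rmax_Cmod ((p, q) - (x, y))%C) as Hm. simpl in Hm.
    replace (p + - x) with (p - x) in Hm by ring.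
    replace (q + - y) with (q - y) in Hm by ring.
    assert (Hp := Rmax_l (Rabs (p - x)) (Rabs (q - y))).
    assert (Hq := Rmax_r (Rabs (p - x)) (Rabs (q - y))).
    assert (Hdu' := Rmin_l du dv). assert (Hdv' := Rmin_r du dv).
    specialize (Hdu p q ltac:(lra) ltac:(lra)).
    specialize (Hdv p q ltac:(lra) ltac:(lra)).
    simpl in Hdu, Hdv.
    eapply Rle_trans; [apply Cmod_2Rmax|]. simpl.
    replace (u p q + - u x y + - ((p + - x) * a - (q + - y) * b))
      with (u p q - u x y - (a * (p - x) + - b * (q - y))) by ring.
    replace (v p q + - v x y + - ((p + - x) * b + (q + - y) * a))
      with (v p q - v x y - (b * (p - x) + a * (q - y))) by ring.
    assert (Hs : sqrt 2 <= 2).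
    { rewrite <- (sqrt_square 2) at 2 by lra. apply sqrt_le_1_alt. lra. }
    set (M := Rmax (Rabs (p - x)) (Rabs (q - y))) in *.
    assert (He := cond_pos eps).
    apply Rle_trans with (2 * (eps / 2 * M)).
    + apply Rmult_le_compat; try assumption.
      * apply sqrt_pos.
      * eapply Rle_trans; [apply Rabs_pos | apply Rmax_l].
      * apply Rmax_lub; assumption.
    + replace (2 * (eps / 2 * M)) with (eps * M) by field.
      apply Rmult_le_compat_l; lra.
Qed.

Lemma differentiable_pt_lim_mult (x y : R) :
  differentiable_pt_lim Rmult x y y x.
Proof.
  intros eps. exists eps. intros u v Hu Hv.
  replace (u * v - x * y - (y * (u - x) + x * (v - y)))
    with ((u - x) * (v - y)) by ring.
  rewrite Rabs_mult. apply Rmult_le_compat; try apply Rabs_pos.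
  - lra.
  - apply Rmax_r.
Qed.

Lemma differentiable_pt_lim_plus (x y : R) :
  differentiable_pt_lim Rplus x y 1 1.
Proof.
  intros eps. exists eps. intros u v _ _.
  replace (u + v - (x + y) - (1 * (u - x) + 1 * (v - y))) with 0 by ring.
  rewrite Rabs_R0. apply Rmult_le_pos; [apply Rlt_le, cond_pos|].
  eapply Rle_trans; [apply Rabs_pos | apply Rmax_l].
Qed.

Lemma differentiable_pt_lim_fst (g : R -> R) (x y l : R) :
  is_derive g x l -> differentiable_pt_lim (fun u _ => g u) x y l 0.
Proof.
  intros H. apply differentiable_pt_lim_proj1_0, is_derive_Reals, H.
Qed.

Lemma differentiable_pt_lim_snd (g : R -> R) (x y l : R) :
  is_derive g y l -> differentiable_pt_lim (fun _ v => g v) x y 0 l.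
Proof.
  intros H eps.
  destruct (differentiable_pt_lim_fst g y x l H eps) as [d Hd].
  exists d. intros u v Hu Hv. rewrite Rmax_comm.
  replace (0 * (u - x) + l * (v - y)) with (l * (v - y) + 0 * (u - x)) by ring.
  apply Hd; assumption.
Qed.

(** * The principal logarithm on the right half-plane *)

(** Removes the case distinction of [Carg], leaving a formula that can be differentiated by the real
    chain rule. *)
Lemma Clog_right_half_plane (w : C) :
  0 < Re w ->
  Clog w = (ln (Re w ^ 2 + Im w ^ 2) / 2, atan (Im w / Re w)).
Proof.
  destruct w as [x y]; simpl; intros Hx. unfold Clog, Carg, Cmod; simpl.
  assert (Hpos : 0 < x * (x * 1) + y * (y * 1)) by nra.
  assert (Hs := sqrt_lt_R0 _ Hpos).
  f_equal.
  - rewrite <- (sqrt_sqrt (x * (x * 1) + y * (y * 1))) at 2 by lra.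
    rewrite ln_mult by assumption. field.
  (* Evenness of [cos (atan t)] allows either sign of [t]; the sign is then chosen so that [atan t]
     lies in the range where [acos] inverts [cos]. *)
  - assert (Hcos : forall t, t = y / x \/ t = - (y / x) ->
      x / sqrt (x * (x * 1) + y * (y * 1)) = cos (atan t)).
    { intros t Ht. rewrite cos_atan.
      replace (1 + t²) with ((x * (x * 1) + y * (y * 1)) / (x * x)).
      2: { destruct Ht; subst t; unfold Rsqr; field; lra. }
      rewrite sqrt_div by nra. rewrite sqrt_square by lra. field; lra. }
    pose proof PI_RGT_0 as HPI.
    destruct (Rle_dec 0 y) as [Hy|Hy].
    + rewrite (Hcos (y / x)) by (left; reflexivity). apply acos_cos.
      destruct (atan_bound (y / x)) as [_ H].
      assert (0 <= y / x) by (apply Rdiv_le_0_compat; lra).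
      destruct (Rle_lt_or_eq_dec _ _ H0) as [H1|H1].
      * apply atan_increasing in H1. rewrite atan_0 in H1. lra.
      * rewrite <- H1, atan_0. lra.
    + rewrite (Hcos (- (y / x))) by (right; reflexivity). rewrite acos_cos.
      * rewrite atan_opp; ring.
      * destruct (atan_bound (- (y / x))) as [_ H].
        assert (0 < - (y / x)).
        { replace (- (y / x)) with (- y / x) by (field; lra).
          apply Rdiv_lt_0_compat; lra. }
        apply atan_increasing in H0. rewrite atan_0 in H0. lra.
Qed.

Lemma is_derive_Clog (w : C) :
  0 < Re w -> @is_derive C_AbsRing C_NormedModule Clog w (/ w)%C.
Proof.
  destruct w as [x y]; simpl; intros Hx.
  assert (Hpos : 0 < x ^ 2 + y ^ 2) by nra.
  apply (is_derive_ext_loc (K := C_AbsRing) (V := C_NormedModule)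
    (fun z : C => (ln (Re z ^ 2 + Im z ^ 2) / 2, atan (Im z / Re z)))).
  (* The disk of radius [x] about [(x, y)] stays in the right half-plane. *)
  { exists (mkposreal x Hx). intros [p q] Hz.
    change (Cmod ((p, q) - (x, y))%C < x) in Hz.
    symmetry. apply Clog_right_half_plane. simpl.
    pose proof (Rmax_Cmod ((p, q) - (x, y))%C) as Hm. simpl in Hm.
    assert (Hp := Rmax_l (Rabs (p + - x)) (Rabs (q + - y))).
    assert (H : Rabs (p + - x) < x) by lra. apply Rabs_def2 in H. lra. }
  unfold Cinv; simpl.
  apply (is_derive_Cauchy_Riemann (fun p q => ln (p ^ 2 + q ^ 2) / 2)
           (fun p q => atan (q / p))).
  (* The partials are rewritten in the shape produced by the two-variable chain rule. Its outer
     function takes two arguments, so [ln t / 2] gets a dummy second one, fed with the constant 0;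
     [atan] is treated alike below. *)
  - replace (x / (x * (x * 1) + y * (y * 1))) with
      (/ (2 * (x ^ 2 + y ^ 2)) * (1 * (2 * x) + 1 * 0) + 0 * 0) by (field; nra).
    replace (- (- y / (x * (x * 1) + y * (y * 1)))) with
      (/ (2 * (x ^ 2 + y ^ 2)) * (1 * 0 + 1 * (2 * y)) + 0 * 0) by (field; nra).
    apply (differentiable_pt_lim_comp (fun t _ => ln t / 2)
      (fun p q => p ^ 2 + q ^ 2) (fun _ _ => 0)).
    + apply (differentiable_pt_lim_fst (fun t => ln t / 2)).
      auto_derive; [lra | field; lra].
    + apply (differentiable_pt_lim_comp Rplus (fun p _ => p ^ 2) (fun _ q => q ^ 2)).
      * apply differentiable_pt_lim_plus.
      * apply (differentiable_pt_lim_fst (fun t => t ^ 2)). auto_derive; [easy | ring].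
      * apply (differentiable_pt_lim_snd (fun t => t ^ 2)). auto_derive; [easy | ring].
    + apply (differentiable_pt_lim_fst (fun t => 0)). auto_derive; easy.
  - replace (- y / (x * (x * 1) + y * (y * 1))) with
      (/ (1 + (y / x) ^ 2) * (/ x * 0 + y * (- / x ^ 2)) + 0 * 0)
      by (field; split; nra).
    replace (x / (x * (x * 1) + y * (y * 1))) with
      (/ (1 + (y / x) ^ 2) * (/ x * 1 + y * 0) + 0 * 0)
      by (field; split; nra).
    apply (differentiable_pt_lim_comp (fun t _ => atan t)
      (fun p q => q / p) (fun _ _ => 0)).
    + apply (differentiable_pt_lim_fst atan).
      auto_derive; [easy | field; nra].
    + apply (differentiable_pt_lim_comp Rmult (fun _ q => q) (fun p _ => / p)).
      * apply differentiable_pt_lim_mult.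
      * apply (differentiable_pt_lim_snd (fun t => t)). auto_derive; [easy | ring].
      * apply (differentiable_pt_lim_fst (fun t => / t)). auto_derive; [lra | field; lra].
    + apply (differentiable_pt_lim_fst (fun t => 0)). auto_derive; easy.
Qed.

(* The two normed-module structures on [C] have convertible norms but are not
   convertible themselves; [is_derive_comp] uses both. *)
Lemma is_derive_C_AbsRing (f : C -> C) (z l : C) :
  @is_derive C_AbsRing (AbsRing_NormedModule C_AbsRing) f z l <->
  @is_derive C_AbsRing C_NormedModule f z l.
Proof.
  split; intros [_ H]; split; try exact H; apply (is_linear_scal_l (K := C_AbsRing)).
Qed.

Lemma is_derive_Cscal (k : C) (f : C -> C) (z l : C) :
  @is_derive C_AbsRing C_NormedModule f z l ->
  @is_derive C_AbsRing C_NormedModule (fun x => k * f x)%C z (k * l)%C.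
Proof.
  intros H.
  apply (filterdiff_ext_lin (K := C_AbsRing) (U := AbsRing_NormedModule C_AbsRing)
    (V := C_NormedModule) _ (fun y : C => k * (y * l))%C).
  - exact (filterdiff_scal_r_fct (K := C_AbsRing) (U := AbsRing_NormedModule C_AbsRing)
      (V := C_NormedModule) k f (fun y : C => scal y l) Cmult_comm H).
  - intros y. change (k * (y * l) = y * (k * l))%C. ring.
Qed.

(** * Derivatives of [Rfun], its rotations and [Ffun] *)

Lemma Re_lt_1_of_in_disk (z : C) : in_disk z -> Re z < 1.
Proof.
  unfold in_disk; intros H. pose proof (re_le_Cmod z).
  pose proof (Rle_abs (Re z)). lra.
Qed.

(** This is the half-plane map [(1 + z) / (1 - z)], with [z] occurring only in the denominator. *)
Definition Rfun' (z : C) : C := (2 / (1 - z) - 1)%C.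

Lemma is_derive_Rfun (z : C) :
  in_disk z -> @is_derive C_AbsRing C_NormedModule Rfun z (Rfun' z).
Proof.
  intros Hz. apply Re_lt_1_of_in_disk in Hz.
  assert (Hw : (1 - z)%C <> 0%C).
  { intros E. apply (f_equal Re) in E. destruct z; simpl in *. lra. }
  replace (Rfun' z) with (- (1) - 2 * (- (1) * / (1 - z)))%C
    by (unfold Rfun'; field; exact Hw).
  apply (is_derive_minus (K := C_AbsRing) (V := C_NormedModule)
    (fun z => - z)%C (fun z => 2 * Clog (1 - z))%C z
    (- (1))%C (2 * (- (1) * / (1 - z)))%C).
  - apply (is_derive_opp (K := C_AbsRing) (V := C_NormedModule) (fun z => z) z (RtoC 1)).
    apply is_derive_C_AbsRing, (is_derive_id (K := C_AbsRing)).
  - apply is_derive_Cscal.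
    apply (is_derive_comp (K := C_AbsRing) (V := C_NormedModule) Clog
      (fun z => 1 - z)%C).
    + apply is_derive_Clog. destruct z; simpl in *. lra.
    + replace (- (1))%C with (0 - 1)%C by ring.
      apply (is_derive_minus (K := C_AbsRing)
        (V := AbsRing_NormedModule C_AbsRing)
        (fun _ => RtoC 1) (fun z => z) z (RtoC 0) (RtoC 1)).
      * exact (is_derive_const (K := C_AbsRing)
          (V := AbsRing_NormedModule C_AbsRing) (RtoC 1) z).
      * apply (is_derive_id (K := C_AbsRing)).
Qed.

Lemma Cmod_cis (t : R) : Cmod (cis t) = 1.
Proof.
  unfold Cmod, cis; simpl. pose proof (sin2_cos2 t) as H. unfold Rsqr in H.
  rewrite <- sqrt_1 at 3. f_equal. lra.
Qed.

Lemma cis_opp_r (t : R) : (cis t * cis (- t))%C = 1%C.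
Proof.
  unfold cis, Cmult, RtoC; simpl. rewrite cos_neg, sin_neg.
  pose proof (sin2_cos2 t) as H. unfold Rsqr in H. f_equal; lra.
Qed.

Lemma in_disk_cis (t : R) (z : C) : in_disk z -> in_disk (cis t * z)%C.
Proof. unfold in_disk. now rewrite Cmod_mult, Cmod_cis, Rmult_1_l. Qed.

(** The outer factor [cis t] cancels the factor [cis (- t)] coming from the chain rule. *)
Lemma is_derive_Rrot (t : R) (z : C) :
  in_disk z ->
  @is_derive C_AbsRing C_NormedModule (Rrot t) z (Rfun' (cis (- t) * z)).
Proof.
  intros Hz.
  replace (Rfun' (cis (- t) * z))
    with (cis t * (cis (- t) * Rfun' (cis (- t) * z)))%C
    by (rewrite Cmult_assoc, cis_opp_r; ring).
  apply is_derive_Cscal.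
  apply (is_derive_comp (K := C_AbsRing) (V := C_NormedModule) Rfun
    (fun z => cis (- t) * z)%C).
  - now apply is_derive_Rfun, in_disk_cis.
  - rewrite <- (Cmult_1_r (cis (- t))) at 1.
    apply is_derive_C_AbsRing, (is_derive_Cscal (cis (- t)) (fun z => z) z 1%C).
    apply is_derive_C_AbsRing, (is_derive_id (K := C_AbsRing)).
Qed.

Definition Ffun' (s : R) (z : C) : C :=
  (s * Rfun' z + (1 - s) * Rfun' (cis (- (PI / 2)) * z))%C.

Lemma is_derive_Ffun (s : R) (z : C) :
  in_disk z -> @is_derive C_AbsRing C_NormedModule (Ffun s) z (Ffun' s z).
Proof.
  intros Hz.
  apply (is_derive_plus (K := C_AbsRing) (V := C_NormedModule)
    (fun z => s * Rfun z)%C (fun z => (1 - s) * Rrot (PI / 2) z)%C z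
    (s * Rfun' z)%C ((1 - s) * Rfun' (cis (- (PI / 2)) * z))%C).
  - now apply is_derive_Cscal, is_derive_Rfun.
  - now apply is_derive_Cscal, is_derive_Rrot.
Qed.

(** * Membership in [class_R] *)

(** The real part is the Poisson kernel [(1 - |z|^2) / |1 - z|^2]. *)
Lemma Re_Rfun'_pos (z : C) : in_disk z -> 0 < Re (Rfun' z).
Proof.
  intros Hz. pose proof (Re_lt_1_of_in_disk z Hz) as H1.
  unfold in_disk in Hz. pose proof (Cmod_ge_0 z) as H0.
  assert (Hsq : Cmod z * Cmod z < 1) by nra.
  unfold Cmod in Hsq. rewrite sqrt_sqrt in Hsq by nra.
  destruct z as [x y]; simpl in *.
  match goal with |- 0 < ?e =>
    replace e with ((1 - (x * x + y * y)) / ((1 - x) * (1 - x) + y * y))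
  end.
  - apply Rdiv_lt_0_compat; nra.
  - field. repeat split; nra.
Qed.

Lemma Re_Cscal_plus (s : R) (a b : C) :
  Re (s * a + (1 - s) * b)%C = s * Re a + (1 - s) * Re b.
Proof. destruct a, b; simpl; ring. Qed.

Lemma Im_Cscal_plus (s : R) (a b : C) :
  Im (s * a + (1 - s) * b)%C = s * Im a + (1 - s) * Im b.
Proof. destruct a, b; simpl; ring. Qed.

Lemma Rfun_val (x y : R) :
  x < 1 ->
  Rfun (x, y) = (- x - ln ((1 - x) ^ 2 + y ^ 2), - y + 2 * atan (y / (1 - x))).
Proof.
  intros Hx. unfold Rfun. rewrite Clog_right_half_plane by (simpl; lra).
  unfold RtoC, Cminus, Cmult, Cplus, Copp; simpl.
  replace ((0 + - y) / (1 + - x)) with (- (y / (1 - x))) by (field; lra).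
  rewrite atan_opp.
  replace ((1 + - x) * ((1 + - x) * 1) + (0 + - y) * ((0 + - y) * 1))
    with ((1 - x) * ((1 - x) * 1) + y * (y * 1)) by ring.
  f_equal; field.
Qed.

Lemma class_R_Ffun (s : R) : 0 < s < 1 -> class_R (Ffun s).
Proof.
  intros Hs. split; [split; [|split]|].
  - intros z Hz. exists (Ffun' s z). now apply is_derive_Ffun.
  - assert (HR : Rfun 0 = 0%C).
    { change (Rfun (0, 0) = (0, 0)). rewrite Rfun_val by lra.
      replace ((1 - 0) ^ 2 + 0 ^ 2) with 1 by ring.
      replace (0 / (1 - 0)) with 0 by field.
      rewrite ln_1, atan_0. f_equal; ring. }
    unfold Ffun, Rrot. rewrite Cmult_0_r, HR. ring.
  - apply is_C_derive_unique.
    replace (RtoC 1) with (Ffun' s (RtoC 0)).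
    + apply is_derive_Ffun. unfold in_disk. rewrite Cmod_0. lra.
    + unfold Ffun', Rfun'. rewrite Cmult_0_r.
      unfold RtoC, Cminus, Cdiv, Cinv, Cmult, Cplus, Copp; simpl. f_equal; field.
  - intros z Hz. rewrite (is_C_derive_unique _ _ _ (is_derive_Ffun s z Hz)).
    unfold Ffun'. rewrite Re_Cscal_plus.
    pose proof (Re_Rfun'_pos z Hz).
    pose proof (Re_Rfun'_pos _ (in_disk_cis (- (PI / 2)) z Hz)). nra.
Qed.

(** * Failure of starlikeness near the point 1 *)

(** For [a] in the second quadrant and [b] in the fourth, both terms of [Re a * Re b + Im a * Im b],
    the numerator of the real part of the quotient, are negative. *)
Lemma Re_div_neg (a b : C) :
  Re a < 0 -> 0 < Im a -> 0 < Re b -> Im b < 0 -> Re (a / b)%C < 0.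
Proof.
  destruct a as [p q], b as [u v]; simpl; intros.
  match goal with |- ?e < 0 =>
    replace e with (- ((- (p * u) + - (q * v)) / (u * u + v * v)))
  end.
  - assert (0 < (- (p * u) + - (q * v)) / (u * u + v * v)); [|lra].
    apply Rdiv_lt_0_compat; nra.
  - field. nra.
Qed.

Lemma cis_opp_PI2_mult (x y : R) : (cis (- (PI / 2)) * (x, y))%C = (y, - x).
Proof.
  unfold cis. rewrite cos_neg, sin_neg, cos_PI2, sin_PI2.
  unfold Cmult; simpl. f_equal; ring.
Qed.

Lemma Rrot_PI2_val (x y : R) :
  y < 1 ->
  Rrot (PI / 2) (x, y) =
    (- x + 2 * atan (x / (1 - y)), - y - ln ((1 - y) ^ 2 + x ^ 2)).
Proof.
  intros Hy. unfold Rrot. rewrite cis_opp_PI2_mult, Rfun_val by assumption.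
  unfold cis. rewrite cos_PI2, sin_PI2.
  replace (- x / (1 - y)) with (- (x / (1 - y))) by (field; lra).
  rewrite atan_opp.
  replace ((- x) ^ 2) with (x ^ 2) by ring.
  unfold Cmult; simpl. f_equal; ring.
Qed.

(* On the curve [z = (1 - y^2, y)], tangent to the unit circle at 1, the
   logarithmically growing [Re (F z)] meets a negative [Re (z F'(z))], so no
   comparison of growth rates is needed. *)
Definition tangent_pt (y : R) : C := (1 - y ^ 2, y).

Lemma in_disk_tangent_pt (y : R) : 0 < y < 1 -> in_disk (tangent_pt y).
Proof.
  intros Hy. unfold in_disk, Cmod, tangent_pt; simpl.
  assert (0 < y * y < 1) by nra.
  apply Rlt_le_trans with (sqrt 1); [|rewrite sqrt_1; lra].
  apply sqrt_lt_1_alt. nra.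
Qed.

(** With [z = tangent_pt y], [|1 + i z|^2 = (1 - y)^2 + (1 - y^2)^2] is [1 - y] times this; that
    factor cancels in the quotients below. *)
Definition den_tangent_pt (y : R) : R := (1 - y) * (1 + (1 + y) ^ 2).

(* [F'(1 - y^2 + i y) = reF' + i imF' / y]; both have finite limits at [y = 0]. *)
Definition reF' (s y : R) : R := - 1 + 2 * s / (1 + y ^ 2) + 2 * (1 - s) / den_tangent_pt y.

Definition imF' (s y : R) : R :=
  2 * s / (1 + y ^ 2) - 2 * (1 - s) * y * (1 + y) / den_tangent_pt y.

Lemma Ffun'_tangent_pt (s y : R) :
  0 < y < 1 -> Ffun' s (tangent_pt y) = (reF' s y, imF' s y / y).
Proof.
  intros Hy. unfold Ffun', tangent_pt. rewrite cis_opp_PI2_mult.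
  unfold Rfun', reF', imF', den_tangent_pt, RtoC, Cminus, Cdiv, Cinv, Cmult, Cplus, Copp; simpl.
  assert (0 < (1 - y) * (1 - y)) by nra.
  pose proof (Rle_0_sqr (1 - y * y)) as Hsq. unfold Rsqr in Hsq.
  f_equal; field; repeat split; nra.
Qed.

(** Both summands are positive. In the first, the logarithm is at most -1, which leaves at least
    [y^2]; in the second, [2 * atan (1 + y) >= PI / 2 > 1]. *)
Lemma Re_Ffun_tangent_pt_pos (s y : R) :
  0 < s < 1 -> 0 < y < 1 / 2 -> 0 < Re (Ffun s (tangent_pt y)).
Proof.
  intros Hs Hy. unfold Ffun, tangent_pt.
  rewrite Re_Cscal_plus, Rrot_PI2_val, Rfun_val by nra. cbn [Re fst].
  assert (Hln : ln ((1 - (1 - y ^ 2)) ^ 2 + y ^ 2) <= - (1)).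
  { rewrite <- (ln_exp (- (1))). apply ln_le; [nra|].
    (* For [y < 1 / 2] the argument [y^4 + y^2] is below [5 / 16], and [/ 3] is at most [exp (- 1)]
       because [exp 1 <= 3]. *)
    apply Rle_trans with (/ 3).
    - assert (y ^ 2 < 1 / 4) by nra. assert (0 <= y ^ 2) by nra. nra.
    - rewrite exp_Ropp. apply Rinv_le_contravar; [apply exp_pos | apply exp_le_3]. }
  assert (Hat : PI / 4 <= atan ((1 - y ^ 2) / (1 - y))).
  { rewrite <- atan_1. left. apply atan_increasing.
    replace ((1 - y ^ 2) / (1 - y)) with (1 + y) by (field; lra). lra. }
  pose proof PI2_1.
  assert (0 < y ^ 2) by nra.
  apply Rplus_lt_0_compat; apply Rmult_lt_0_compat; lra.
Qed.

(** Bounding [2 * atan (y / y^2)] by its limit [PI] gives an upper bound that is differentiable at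
    [y = 0], where the original expression jumps. *)
Lemma Im_Ffun_tangent_pt_lt (s y : R) :
  0 < s < 1 -> 0 < y < 1 ->
  Im (Ffun s (tangent_pt y)) <
    s * PI + (1 - s) * (- y - ln ((1 - y) ^ 2 + (1 - y ^ 2) ^ 2)).
Proof.
  intros Hs Hy. unfold Ffun, tangent_pt.
  rewrite Im_Cscal_plus, Rrot_PI2_val, Rfun_val by nra. cbn [Im snd].
  destruct (atan_bound (y / (1 - (1 - y ^ 2)))) as [_ H]. nra.
Qed.

Lemma locally_neg (g : R -> R) (x : R) :
  ex_derive g x -> g x < 0 -> locally x (fun t => g t < 0).
Proof.
  intros Hg Hx. apply (ex_derive_continuous g x Hg (fun t => t < 0)).
  now apply open_lt.
Qed.

Theorem theorem4p1 : forall s : R,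
  0 < s < ln 2 / (PI + ln 2) ->
  class_R (Ffun s) /\ ~ class_Sstar (Ffun s).
Proof.
  intros s [Hs0 Hs1]. pose proof PI_RGT_0 as HPI. pose proof ln_lt_2 as Hln2.
  (* The bound on [s] with its denominator cleared; this is the limit of [Im F] at 1 along the
     curve. *)
  assert (HsL : s * PI - (1 - s) * ln 2 < 0).
  { apply (Rmult_lt_compat_r (PI + ln 2)) in Hs1; [|lra].
    unfold Rdiv in Hs1. rewrite Rmult_assoc, Rinv_l in Hs1; lra. }
  assert (Hs : 0 < s < 1) by nra.
  split; [now apply class_R_Ffun|].
  intros [_ [_ [_ [Hstar _]]]].
  (* This is [Re (z F')]. Since [reF' s 0 = s] and [imF' s 0 = 2 * s], its value at 0 is [- s]. *)
  assert (H1 : locally 0 (fun y => (1 - y ^ 2) * reF' s y - imF' s y < 0)).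
  { apply (locally_neg (fun y => (1 - y ^ 2) * reF' s y - imF' s y));
      unfold reF', imF', den_tangent_pt.
    - auto_derive. repeat split; lra.
    - field_simplify; lra. }
  (* This is [- y * Im (z F')]; the factor [y] removes the pole, and the value at 0 is [- 2 * s]. *)
  assert (H2 : locally 0
    (fun y => - ((1 - y ^ 2) * imF' s y + y ^ 2 * reF' s y) < 0)).
  { apply (locally_neg (fun y => - ((1 - y ^ 2) * imF' s y + y ^ 2 * reF' s y)));
      unfold reF', imF', den_tangent_pt.
    - auto_derive. repeat split; lra.
    - field_simplify; lra. }
  assert (H3 : locally 0 (fun y =>
    s * PI + (1 - s) * (- y - ln ((1 - y) ^ 2 + (1 - y ^ 2) ^ 2)) < 0)).
  { apply (locally_neg (fun y =>
      s * PI + (1 - s) * (- y - ln ((1 - y) ^ 2 + (1 - y ^ 2) ^ 2)))).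
    - auto_derive. lra.
    - replace ((1 - 0) ^ 2 + (1 - 0 ^ 2) ^ 2) with 2 by ring. lra. }
  destruct (filter_and _ _ H1 (filter_and _ _ H2 H3)) as [d Hd].
  pose proof (cond_pos d) as Hdp.
  (* Halving the minimum makes [y] strictly smaller than both [d] and [1 / 2]. *)
  assert (Hy : 0 < Rmin d (1 / 2) / 2).
  { apply Rdiv_lt_0_compat; [apply Rmin_pos|]; lra. }
  pose proof (Rmin_l d (1 / 2)). pose proof (Rmin_r d (1 / 2)).
  set (y := Rmin d (1 / 2) / 2) in *.
  assert (Hyd : y < d) by (unfold y in *; lra).
  assert (Hy1 : y < 1 / 2) by (unfold y in *; lra).
  clearbody y.
  destruct (Hd y) as [K1 [K2 K3]].
  { change (Rabs (y - 0) < d). rewrite Rminus_0_r, Rabs_pos_eq; lra. }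
  assert (Hdisk : in_disk (tangent_pt y)) by (apply in_disk_tangent_pt; lra).
  destruct (Hstar (tangent_pt y) Hdisk) as [_ Hpos].
  { intros E. apply (f_equal Im) in E. unfold tangent_pt in E. simpl in E. lra. }
  rewrite (is_C_derive_unique _ _ _ (is_derive_Ffun s _ Hdisk)) in Hpos.
  rewrite Ffun'_tangent_pt in Hpos by lra.
  apply (Rlt_irrefl 0), (Rlt_trans _ _ _ Hpos), Re_div_neg.
  - unfold tangent_pt, Cmult. cbn [Re fst snd].
    replace (y * (imF' s y / y)) with (imF' s y) by (field; lra). exact K1.
  - unfold tangent_pt, Cmult. cbn [Im fst snd].
    replace ((1 - y ^ 2) * (imF' s y / y) + y * reF' s y)
      with (((1 - y ^ 2) * imF' s y + y ^ 2 * reF' s y) / y) by (field; lra).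
    apply Rdiv_lt_0_compat; lra.
  - apply Re_Ffun_tangent_pt_pos; lra.
  - eapply Rlt_trans; [apply Im_Ffun_tangent_pt_lt; lra | exact K3].
Qed.
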